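(* Let $G=(V,E)$ be a simple directed graph with $V=\{1,\dots,n\}$ and let $f\ge 0$ be an integer. Asynchronous approximate consensus is possible in network $G$ in the presence of up to $f$ Byzantine faults if and only if $G$ satisfies the 3-reach condition: for any nodes $u,v\in V$ and any node subsets $F,F_u,F_v\subseteq V$ with $|F|,|F_u|,|F_v|\le f$, $u\notin F\cup F_u$ and $v\notin F\cup F_v$, we have $$reach_v(F\cup F_v)\cap reach_u(F\cup F_u)\neq\emptyset.$$
   Context: System model: $n$ nodes communicate by message passing over the directed graph $G$; node $i$ can reliably send messages to node $j$ iff $(i,j)\in E$ (self-loops are excluded from $E$, but each node can send messages to itself). The system is asynchronous: links are reliable but message delays are finite and not known a priori. At most $f$ nodes may be Byzantine faulty, i.e., behave arbitrarily and possibly collude. Approximate consensus: each node gets a real-valued input, and for a given $\epsilon>0$ an algorithm must guarantee (Convergence) the outputs of any two nonfaulty nodes are within $\epsilon$ of each other; (Validity) the output of every nonfaulty node lies within the range of the inputs of the nonfaulty nodes; (Termination) all nonfaulty nodes eventually output a value. For $Y\subseteq V$, $G_Y$ denotes the subgraph of $G$ induced by $Y$, and $\overline{X}=V\setminus X$. For a node $v$ and $F\subseteq V\setminus\{v\}$, $reach_v(F)=\{u\in\overline{F}: u \text{ has a directed path to } v \text{ in } G_{\overline{F}}\}$ (so $v\in reach_v(F)$). *)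

(* Defs.v *)
From mathcomp Require Import all_boot all_order all_algebra.
From mathcomp Require Import Rstruct.

Set Implicit Arguments.
Unset Strict Implicit.
Unset Printing Implicit Defensive.
Import Order.TTheory GRing.Theory Num.Theory.
Local Open Scope ring_scope.

Notation Real := Rdefinitions.R.

Section Model.
Variable n : nat.
(* Directed graph on V = 'I_n: E i j means (i,j) is a link, i.e. i can send to j. *)
Variable E : rel 'I_n.

Definition induced_rel (F : {set 'I_n}) : rel 'I_n :=
  [rel a b | [&& a \notin F, b \notin F & E a b]].

Definition reach (F : {set 'I_n}) (v : 'I_n) : {set 'I_n} :=
  [set u | (u \notin F) && connect (induced_rel F) u v].

Definition three_reach (f : nat) : Prop :=
  forall (u v : 'I_n) (F Fu Fv : {set 'I_n}),
    (#|F| <= f)%N -> (#|Fu| <= f)%N -> (#|Fv| <= f)%N ->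
    u \notin F :|: Fu -> v \notin F :|: Fv ->
    reach (F :|: Fv) v :&: reach (F :|: Fu) u != set0.

(* A deterministic node's local state is a function of its input and  *)
(* of the sequence of (sender, message) pairs it has received; hence   *)
(* an algorithm is given by:                                          *)
(*  - a_send i x h k : the messages node i (input x) sends to node k   *)
(*    in the step at which its receive history becomes h (h = [::] is  *)
(*    the initial step);  messages are only carried on links (j,k) of  *)
(*    E or to itself (k = i);                                          *)
(*  - a_dec i x h : Some y if node i with history h has decided y.     *)
(*    The output is the first decision taken (irrevocable).            *)

Record algorithm (Msg : eqType) := Algorithm {
  a_send : 'I_n -> Real -> seq ('I_n * Msg) -> 'I_n -> seq Msg;
  a_dec  : 'I_n -> Real -> seq ('I_n * Msg) -> option Real }.

Variable Msg : eqType.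
Variable A : algorithm Msg.

Definition prefixes (T : Type) (h : seq T) : seq (seq T) :=
  [seq take l h | l <- iota 0 (size h).+1].

Definition sent_count (xj : Real) (j : 'I_n) (hj : seq ('I_n * Msg))
    (k : 'I_n) (m : Msg) : nat :=
  \sum_(p <- prefixes hj) count (pred1 m) (a_send A j xj p k).

Definition recv_count (hi : seq ('I_n * Msg)) (j : 'I_n) (m : Msg) : nat :=
  count (pred1 (j, m)) hi.

Definition link (j i : 'I_n) : bool := E j i || (j == i).

(* An (infinite) asynchronous execution with faulty set F and inputs x:
   hist t i is the receive history of node i at global time t.
   Faulty nodes behave arbitrarily (their histories are unconstrained and
   the messages they deliver on their outgoing links are arbitrary). *)
Definition admissible (F : {set 'I_n}) (x : 'I_n -> Real)
    (hist : nat -> 'I_n -> seq ('I_n * Msg)) : Prop :=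
  (forall i, i \notin F -> hist 0%N i = [::]) /\
  (forall t i, i \notin F ->
     hist t.+1 i = hist t i \/ exists e, hist t.+1 i = rcons (hist t i) e) /\
  (forall t i j m, i \notin F -> (j, m) \in hist t i -> link j i) /\
  (* messages from nonfaulty senders are genuine: no forging/duplication,
     and only messages already sent can be received *)
  (forall t i j m, i \notin F -> j \notin F ->
     (recv_count (hist t.+1 i) j m <= sent_count (x j) j (hist t j) i m)%N) /\
  (* reliable links, finite (unbounded) delays: every message sent between
     nonfaulty nodes along a link is eventually received *)
  (forall t i j m, i \notin F -> j \notin F -> link j i ->
     exists t', (sent_count (x j) j (hist t j) i m <= recv_count (hist t' i) j m)%N).

Definition outputs (x : 'I_n -> Real) (hist : nat -> 'I_n -> seq ('I_n * Msg))
    (i : 'I_n) (y : Real) : Prop :=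
  exists t, a_dec A i (x i) (hist t i) = Some y /\
    forall s, (s < t)%N -> a_dec A i (x i) (hist s i) = None.

Definition solves_approx_consensus (f : nat) (eps : Real) : Prop :=
  forall (F : {set 'I_n}), (#|F| <= f)%N ->
  forall (x : 'I_n -> Real) (hist : nat -> 'I_n -> seq ('I_n * Msg)),
    admissible F x hist ->
    (forall i, i \notin F -> exists y, outputs x hist i y) /\
    (forall i j yi yj, i \notin F -> j \notin F ->
       outputs x hist i yi -> outputs x hist j yj -> `|yi - yj| <= eps) /\
    (forall i y, i \notin F -> outputs x hist i y ->
       exists j k, [/\ j \notin F, k \notin F & x j <= y <= x k]).

End Model.

Definition approx_consensus_possible (n : nat) (E : rel 'I_n) (f : nat) : Prop :=
  forall eps : Real, 0 < eps ->
    exists (Msg : eqType) (A : algorithm n Msg),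
      solves_approx_consensus E A f eps.

(* Main.v *)
Require Import Defs.
From mathcomp Require Import all_boot all_order all_algebra.
From HB Require Import structures.
From mathcomp Require Import Rstruct boolp lra.

(* Necessity: if [reach_v (F :|: Fv)] and [reach_u (F :|: Fu)] are disjoint, run
   the algorithm once with all inputs 0 and [Fv] crashed, once with all inputs 1
   and [Fu] crashed.  An execution with faulty set [F] and slow links looks like
   the first run to [v] and like the second one to [u], so they decide 0 and 1.

   Sufficiency: call [source D] the set of nodes that reach every node outside
   [D] in [G - D].  Under 3-reach, [source (A :|: B)] and [source (A :|: C)] meet
   whenever [A], [B], [C] have at most [f] elements.  Nodes flood their complete
   histories, and each round of averaging goes as follows.  A node that hears
   consistent values [X] from [source A], on paths that avoid [A], echoes
   [(A, X)]; it is ready for [(A, X)] once all of [source A] echoes it, and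
   claims the first [(A, X)] for which all of [source A] is ready.  A claim is
   confirmed by a node when, for every possible faulty set [B], it has heard
   outside [B] that some node outside [A :|: B] is ready.  Claims of nonfaulty
   nodes are eventually confirmed everywhere, and any two confirmed reports
   [(A, X)], [(B, Y)] agree on [source (A :|: B)].  A confirmed report determines
   a point in the range of the nonfaulty values.  A node waits for confirmed
   claims of some [source A] and moves to the midpoint of the corresponding
   points; two nodes always share the claim of a nonfaulty node, so the diameter
   is halved.  The values of any report confirmed in the first round bound the
   new values of all nonfaulty nodes, which tells a node when it may stop. *)

Set Implicit Arguments.
Unset Strict Implicit.
Unset Printing Implicit Defensive.
Import Order.TTheory GRing.Theory Num.Theory.
Local Open Scope ring_scope.

(** * Necessity *)

Section Scheduler.
Variables (n : nat) (E : rel 'I_n) (Msg : eqType) (A : algorithm n Msg).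
Implicit Types (x : 'I_n -> Real) (i j : 'I_n) (Z : {set 'I_n}).
Notation history := (seq ('I_n * Msg)).

Definition outbox x j (h : history) i : seq Msg :=
  flatten [seq a_send A j (x j) p i | p <- prefixes h].

Definition inbox (h : history) j : seq Msg :=
  [seq e.2 | e <- h & e.1 == j].

Lemma sent_countE x j h i m :
  sent_count A (x j) j h i m = count_mem m (outbox x j h i).
Proof. by rewrite /sent_count /outbox count_flatten sumnE -map_comp big_map. Qed.

Lemma recv_countE (h : history) j m : recv_count h j m = count_mem m (inbox h j).
Proof.
rewrite /recv_count /inbox count_map count_filter; apply: eq_count => -[k a] /=.
by rewrite xpair_eqE andbC.
Qed.

Lemma prefixes_cat T (h g : seq T) : exists s, prefixes (h ++ g) = prefixes h ++ s.
Proof.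
rewrite /prefixes size_cat -addSn iotaD map_cat; eexists; congr (_ ++ _).
by apply/eq_in_map => l; rewrite mem_iota add0n ltnS => /= lh; rewrite takel_cat.
Qed.

Lemma outbox_cat x j h g i : exists s, outbox x j (h ++ g) i = outbox x j h i ++ s.
Proof.
have [s Es] := prefixes_cat h g; rewrite /outbox Es map_cat flatten_cat.
by eexists.
Qed.

(* Links are served in FIFO order: the next message for [i] on the link from
   [j] is the one indexed by the number of messages [i] got from [j] so far. *)
Definition deliver Z x j (H : 'I_n -> history) i : history :=
  if link E j i && (j \notin Z) then
    if ohead (drop (size (inbox (H i) j)) (outbox x j (H j) i)) is Some m
    then rcons (H i) (j, m) else H i
  else H i.

Variable sender : nat -> 'I_n.
Hypothesis sender_fair : forall j t, exists2 t', (t <= t')%N & sender t' = j.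

Fixpoint run Z x (H : 'I_n -> history) (t : nat) : 'I_n -> history :=
  if t is s.+1 then deliver Z x (sender s) (run Z x H s) else H.

Definition fifo x (H : 'I_n -> history) j i :=
  exists s, outbox x j (H j) i = inbox (H i) j ++ s.

Lemma inbox_rcons h e j :
  inbox (rcons h e) j = if e.1 == j then rcons (inbox h j) e.2 else inbox h j.
Proof. by rewrite /inbox filter_rcons; case: ifP => //; rewrite map_rcons. Qed.

Lemma deliver_step Z x j H i :
  deliver Z x j H i = H i \/
  exists m, [/\ deliver Z x j H i = rcons (H i) (j, m), link E j i, j \notin Z &
    ohead (drop (size (inbox (H i) j)) (outbox x j (H j) i)) = Some m].
Proof.
rewrite /deliver; case: ifP => [/andP[lji jZ]|]; last by left.
by case D: (ohead _) => [m|]; [right; exists m | left].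
Qed.

Lemma ohead_drop_Some T (s : seq T) l m :
  ohead (drop l s) = Some m -> exists s', s = rcons (take l s) m ++ s'.
Proof.
case D: (drop l s) => [//|a s'] /= [<-]; exists s'.
by rewrite cat_rcons -D cat_take_drop.
Qed.

Lemma fifo_deliver Z x k H j i : fifo x H j i -> fifo x (deliver Z x k H) j i.
Proof.
move=> [s Es]; rewrite /fifo.
have [g ->] : exists g, deliver Z x k H j = H j ++ g.
  have [->|[m [-> _ _ _]]] := deliver_step Z x k H j.
    by exists [::]; rewrite cats0.
  by exists [:: (k, m)]; rewrite cats1.
have [s' ->] := outbox_cat x j (H j) g i.
have [->|[m [-> _ _ om]]] := deliver_step Z x k H i.
  by exists (s ++ s'); rewrite Es catA.
rewrite inbox_rcons /=; case: eqP => [ekj|_]; last by exists (s ++ s'); rewrite Es catA.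
subst k; have [s'' Es''] := ohead_drop_Some om.
by exists (s'' ++ s'); rewrite Es'' Es take_size_cat // catA.
Qed.

Section Run.
Variables (Z : {set 'I_n}) (x : 'I_n -> Real) (H : 'I_n -> history).
Let r := run Z x H.

Lemma run_fifo j i t : fifo x H j i -> fifo x (r t) j i.
Proof. by move=> ?; elim: t => //= t IH; apply: fifo_deliver. Qed.

Lemma runS t i : r t.+1 i = deliver Z x (sender t) (r t) i.
Proof. by []. Qed.

Lemma run_step t i : r t.+1 i = r t i \/ exists e, r t.+1 i = rcons (r t i) e.
Proof.
rewrite runS; have [->|[m [-> _ _ _]]] := deliver_step Z x (sender t) (r t) i.
  by left.
by right; exists (sender t, m).
Qed.

Lemma run_cat t d i : exists g, r (t + d) i = r t i ++ g.
Proof.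
elim: d => [|d [g Eg]]; first by exists [::]; rewrite addn0 cats0.
rewrite addnS; have [->|[e ->]] := run_step (t + d) i; first by exists g.
by exists (rcons g e); rewrite Eg rcons_cat.
Qed.

Lemma run_mem t i j m : (j, m) \in r t i ->
  (j, m) \in H i \/ link E j i /\ j \notin Z.
Proof.
elim: t => [|t IH]; first by left.
rewrite runS; have [-> //|[m' [-> lji jZ _]]] := deliver_step Z x (sender t) (r t) i.
by rewrite mem_rcons inE => /orP[/eqP[-> _]|/IH]; [right|].
Qed.

Lemma run_safe t i j m : fifo x H j i ->
  (recv_count (r t.+1 i) j m <= sent_count A (x j) j (r t j) i m)%N.
Proof.
move=> fH; have [s Es] := run_fifo t fH; rewrite recv_countE sent_countE runS.
have [->|[m' [-> _ _ om]]] := deliver_step Z x (sender t) (r t) i.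
  by rewrite Es count_cat leq_addr.
rewrite inbox_rcons /=; case: eqP => [ej|_]; last by rewrite Es count_cat leq_addr.
rewrite ej in om; have [s' Es'] := ohead_drop_Some om.
by rewrite Es' Es take_size_cat // count_cat leq_addr.
Qed.

(** While [i] has received fewer messages from [j] than were sent by time [t], the next turn of [j]
    delivers one more. Once it has received that many, FIFO order puts all of them in its inbox. *)
Lemma run_live t i j m : fifo x H j i -> link E j i -> j \notin Z ->
  exists t', (sent_count A (x j) j (r t j) i m <= recv_count (r t' i) j m)%N.
Proof.
move=> fH lji jZ.
have [d led] : exists d,
    (size (outbox x j (r t j) i) <= size (inbox (r (t + d) i) j))%N.
  suff: forall N, (N <= size (outbox x j (r t j) i))%N ->
      exists d, (N <= size (inbox (r (t + d) i) j))%N by apply.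
  elim=> [|N IH] ltN; first by exists 0%N.
  have [d led] := IH (ltnW ltN); have [u leu Eu] := sender_fair j (t + d)%N.
  exists (u.+1 - t)%N; have letu : (t <= u)%N by rewrite (leq_trans _ leu) ?leq_addr.
  rewrite subnKC ?(leqW letu) //.
  have [g Eg] := run_cat (t + d) (u - (t + d)) i; rewrite subnKC // in Eg.
  have [g' Eg'] := run_cat t (u - t) j; rewrite subnKC // in Eg'.
  have [s Es] := outbox_cat x j (r t j) g' i; rewrite -Eg' in Es.
  have leNu : (N <= size (inbox (r u i) j))%N.
    by rewrite Eg /inbox filter_cat map_cat size_cat (leq_trans led) ?leq_addr.
  rewrite runS Eu /deliver lji jZ /=.
  case D: (drop _ _) => [|m' s'] /=; last by rewrite inbox_rcons /= eqxx size_rcons.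
  move/(congr1 size): D => /=/eqP; rewrite size_drop subn_eq0; apply: leq_trans.
  by rewrite Es size_cat (leq_trans ltN) ?leq_addr.
exists (t + d)%N; rewrite sent_countE recv_countE.
have [s Es] := run_fifo (t + d) fH; have [g Eg] := run_cat t d j.
have [s' Es'] := outbox_cat x j (r t j) g i.
(* Both lists are prefixes of the outbox of [j] at time [t + d], and the outbox at [t] is the
   shorter one. *)
have -> : outbox x j (r t j) i =
    take (size (outbox x j (r t j) i)) (inbox (r (t + d) i) j).
  by rewrite -(takel_cat s led) -Es Eg Es' take_size_cat.
by rewrite -{2}(cat_take_drop (size (outbox x j (r t j) i)) (inbox _ _))
  count_cat leq_addr.
Qed.

End Run.

(** A prescribed prefix up to time [T], continued by the fair FIFO run: only the finite part needs
    to be designed, since the run supplies eventual delivery. *)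
Definition splice Z x (pre : nat -> 'I_n -> history) T t :=
  if (t <= T)%N then pre t else run Z x (pre T) (t - T).

Lemma splice_run Z x pre T d : splice Z x pre T (T + d) = run Z x (pre T) d.
Proof.
rewrite /splice -{2}[T]addn0 leq_add2l leqn0; case: eqP => [->|_].
  by rewrite addn0.
by rewrite addKn.
Qed.

Lemma splice_admissible Z x pre T :
  (forall i, i \notin Z -> pre 0%N i = [::]) ->
  (forall t i, (t < T)%N -> i \notin Z ->
     pre t.+1 i = pre t i \/ exists e, pre t.+1 i = rcons (pre t i) e) ->
  (forall t i j m, i \notin Z -> (j, m) \in pre t i -> link E j i) ->
  (forall t i j m, (t < T)%N -> i \notin Z -> j \notin Z ->
     (recv_count (pre t.+1 i) j m <= sent_count A (x j) j (pre t j) i m)%N) ->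
  (forall i j, i \notin Z -> j \notin Z -> fifo x (pre T) j i) ->
  admissible E A Z x (splice Z x pre T).
Proof.
move=> pre0 preS preL preC preT; pose hist := splice Z x pre T.
have late t : (T <= t)%N -> hist t = run Z x (pre T) (t - T).
  by move=> letT; rewrite /hist -[in LHS](subnKC letT) splice_run.
have histS t i : i \notin Z ->
    hist t.+1 i = hist t i \/ exists e, hist t.+1 i = rcons (hist t i) e.
  move=> iZ; have [ltT|leT] := ltnP t T.
    by rewrite /hist /splice ltT (ltnW ltT); apply: preS.
  by rewrite !late // ?(leqW leT) // subSn //; apply: run_step.
have histT t j : j \notin Z -> exists g, hist (T + t)%N j = hist t j ++ g.
  move=> jZ; elim: {1}T => [|d [g Eg]]; first by exists [::]; rewrite cats0.
  have [->|[e ->]] := histS (d + t)%N j jZ; first by exists g.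
  by exists (rcons g e); rewrite Eg rcons_cat.
split; first by move=> i iZ; rewrite /splice leq0n pre0.
split; first exact: histS.
split; last split.
- move=> t i j m iZ; have [leT|/ltnW leT] := leqP t T.
    by rewrite /splice leT; apply: preL.
  by rewrite -/(hist t) late // => /run_mem[/preL->|[]].
- move=> t i j m iZ jZ; have [ltT|leT] := ltnP t T.
    by rewrite /splice ltT (ltnW ltT); apply: preC.
  by rewrite -/hist !late // ?(leqW leT) // subSn //; apply: run_safe; apply: preT.
move=> t i j m iZ jZ lji.
have [t' let'] := run_live t m (preT i j iZ jZ) lji jZ.
exists (T + t')%N; rewrite splice_run (leq_trans _ let') // -splice_run -/hist.
have [g ->] := histT t j jZ; have [s Es] := outbox_cat x j (hist t j) g i.
by rewrite !sent_countE Es count_cat leq_addr.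
Qed.
End Scheduler.

(** * Indistinguishable executions *)

Section Necessity.
Variables (n : nat) (E : rel 'I_n).

Lemma reach_pred (D : {set 'I_n}) s t v : t \notin D -> t \in reach E D v ->
  s \notin D -> E s t -> s \in reach E D v.
Proof.
move=> tD; rewrite !inE tD => /= ctv sD Est; rewrite sD /=.
by apply: connect_trans ctv; apply: connect1; rewrite /induced_rel /= sD tD.
Qed.

Lemma three_reach_necessary f :
  approx_consensus_possible E f -> three_reach E f.
Proof.
move=> possible u v F Fu Fv cF cFu cFv uF vF; apply/negP => /eqP disj.
have half_gt0 : (0 : Real) < 1 / 2%:R by lra.
have [Msg [A solve]] := possible _ half_gt0.
have n_gt0 : (0 < n)%N by apply: leq_ltn_trans (ltn_ord u).
pose sender t : 'I_n := Ordinal (ltn_pmod t n_gt0).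
have fair : forall j t, exists2 t', (t <= t')%N & sender t' = j.
  move=> j t; exists (t * n + j)%N.
    by rewrite (leq_trans (leq_pmulr t n_gt0)) ?leq_addr.
  by apply: val_inj; rewrite /= modnMDl modn_small.
pose Rv := reach E (F :|: Fv) v; pose Ru := reach E (F :|: Fu) u.
(* Prefix length 0: a pure FIFO run with all inputs [c], in which [Z] stays silent. *)
pose solo Z (c : Real) := splice E A sender Z (fun=> c) (fun _ _ => [::]) 0.
have solo_adm Z c : admissible E A Z (fun=> c) (solo Z c).
  by apply: splice_admissible => // i j _ _; eexists; rewrite /= /inbox.
have solo_run Z c t : solo Z c t = run E A sender Z (fun=> c) (fun=> [::]) t.
  exact: splice_run 0%N t.
have solo_fifo Z c t j i : fifo A (fun=> c) (solo Z c t) j i.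
  by rewrite solo_run; apply: run_fifo; eexists; rewrite /inbox.
(* Such a reach set is closed under predecessors outside [F :|: Z], and [Z] is silent, so apart from
   [F] its nodes hear only each other. *)
have solo_mem Z c t w (i j : 'I_n) m : i \in reach E (F :|: Z) w -> j \notin F ->
    (j, m) \in solo Z c t i -> j \in reach E (F :|: Z) w.
  rewrite solo_run => iR jF /run_mem[//|[/orP[Eji|/eqP-> //] jZ]].
  apply: (reach_pred _ iR) => //; last by rewrite inE negb_or jF.
  by move: iR; rewrite inE => /andP[].
have decide w (Z : {set 'I_n}) c : (#|Z| <= f)%N -> w \notin Z ->
    outputs A (fun=> c) (solo Z c) w c.
  move=> cZ wZ; have [ter [_ val]] := solve Z cZ _ _ (solo_adm Z c).
  have [y outy] := ter w wZ; have [j [k [_ _ yc]]] := val w y wZ outy.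
  (* Validity with constant inputs leaves [c] as the only possible output. *)
  by have ec : c = y := le_anti yc; rewrite -ec in outy.
have [|t1 [dec1 nodec1]] := decide v Fv 0 cFv.
  by move: vF; rewrite inE negb_or => /andP[].
have [|t2 [dec2 nodec2]] := decide u Fu 1 cFu.
  by move: uF; rewrite inE negb_or => /andP[].
pose x i : Real := if i \in Ru then 1 else 0.
(* [Rv] replays the run with [Fv] silent and [Ru] the one with [Fu] silent; the other nodes receive
   nothing until both decisions are taken. The faulty set [F] plays a different run towards each
   side. *)
pose pre t i := if i \in Rv then solo Fv 0 t i
                else if i \in Ru then solo Fu 1 t i else [::].
pose hist := splice E A sender F x pre (maxn t1 t2).
have RvN i : i \in Rv -> (i \in Ru = false) * (i \notin Fv).
  move=> iRv; split; last by move: iRv; rewrite !inE negb_or => /andP[/andP[]].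
  apply/negP => iRu; move/setP: disj => /(_ i); rewrite !inE.
  by move: iRv iRu; rewrite !inE => -> ->.
have RuN i : i \in Ru -> i \notin Fu.
  by rewrite !inE negb_or => /andP[/andP[]].
have inbox0 (R : {set 'I_n}) (h : seq ('I_n * Msg)) j : j \notin R ->
    (forall m, (j, m) \in h -> j \in R) -> inbox h j = [::].
  move=> jR hR; rewrite /inbox; suff /eqP-> : [seq e <- h | e.1 == j] == [::] by [].
  rewrite -[_ == _]negbK -has_filter; apply/hasPn => -[k m] kh /=.
  by apply/negP => /eqP ek; subst k; rewrite (hR _ kh) in jR.
have pre_fifo t i j : i \notin F -> j \notin F -> fifo A x (pre t) j i.
  move=> iF jF; rewrite /fifo /pre.
  have [iRv|iRv] := boolP (i \in Rv).
    have [jRv|jRv] := boolP (j \in Rv).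
      have [s] := solo_fifo Fv 0 t j i.
      by exists s; rewrite /outbox /x (RvN _ jRv).1.
    rewrite (inbox0 Rv) //; first by eexists.
    by move=> m; apply: solo_mem iRv jF.
  have [iRu|iRu] := boolP (i \in Ru); last by eexists; rewrite /inbox.
  have [jRu|jRu] := boolP (j \in Ru).
    have jRv : j \in Rv = false by apply/negP => /RvN[]; rewrite jRu.
    have [s] := solo_fifo Fu 1 t j i.
    by exists s; rewrite jRv /outbox /x jRu.
  rewrite (inbox0 Ru) //; first by eexists.
  by move=> m; apply: solo_mem iRu jF.
have adm : admissible E A F x hist.
  apply: splice_admissible => //.
  - by move=> i _; rewrite /pre; do 2!case: ifP => // _.
  - move=> t i _ _; rewrite /pre; case: ifP => [/RvN[_ iFv]|_].
      by case: (solo_adm Fv 0) => _ [+ _]; apply.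
    case: ifP => [/RuN iFu|_]; last by left.
    by case: (solo_adm Fu 1) => _ [+ _]; apply.
  - move=> t i j m _; rewrite /pre; case: ifP => [/RvN[_ iFv]|_].
      by case: (solo_adm Fv 0) => _ [_ [+ _]]; apply.
    case: ifP => [/RuN iFu|_] //.
    by case: (solo_adm Fu 1) => _ [_ [+ _]]; apply.
  - move=> t i j m _ iF jF; rewrite /pre.
    have [iRv|iRv] := boolP (i \in Rv).
      have [jRv|jRv] := boolP (j \in Rv).
        rewrite /x (RvN _ jRv).1; case: (solo_adm Fv 0) => _ [_ [_ [+ _]]]; apply.
          exact: (RvN _ iRv).2.
        exact: (RvN _ jRv).2.
      rewrite recv_countE (inbox0 Rv) // => m'; exact: solo_mem iRv jF.
    have [iRu|iRu] := boolP (i \in Ru); last by rewrite recv_countE.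
    have [jRu|jRu] := boolP (j \in Ru).
      have -> : j \in Rv = false by apply/negP => /RvN[]; rewrite jRu.
      by rewrite /x jRu; case: (solo_adm Fu 1) => _ [_ [_ [+ _]]]; apply; apply: RuN.
    rewrite recv_countE (inbox0 Ru) // => m'; exact: solo_mem iRu jF.
  by move=> i j; apply: pre_fifo.
have [_ [agr _]] := solve F cF x _ adm.
have vRv : v \in Rv by rewrite inE vF connect0.
have uRu : u \in Ru by rewrite inE uF connect0.
have uRv : u \in Rv = false by apply/negP => /RvN[]; rewrite uRu.
have hist_pre t : (t <= maxn t1 t2)%N -> hist t = pre t by rewrite /hist /splice => ->.
suff : `|0 - 1 : Real| <= 1 / 2%:R by rewrite sub0r normrN1; lra.
apply: (agr v u).
- by move: vF; rewrite inE negb_or => /andP[].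
- by move: uF; rewrite inE negb_or => /andP[].
- exists t1; split=> [|s lts]; rewrite hist_pre /pre ?vRv /x ?(RvN _ vRv).1 //.
  + exact: leq_maxl.
  + exact: nodec1.
  + by rewrite (leq_trans (ltnW lts)) ?leq_maxl.
- exists t2; split=> [|s lts]; rewrite hist_pre /pre ?uRv /x ?uRu //.
  + exact: leq_maxr.
  + exact: nodec2.
  + by rewrite (leq_trans (ltnW lts)) ?leq_maxr.
Qed.
End Necessity.

(** * Source components *)

Lemma ex_maximum (I : finType) (P : pred I) (g : I -> Real) i0 :
  P i0 -> exists2 i, P i & forall j, P j -> g j <= g i.
Proof. by move=> Pi0; case: (arg_maxP g Pi0) => i Pi mi; exists i. Qed.

Lemma ex_minimum (I : finType) (P : pred I) (g : I -> Real) i0 :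
  P i0 -> exists2 i, P i & forall j, P j -> g i <= g j.
Proof. by move=> Pi0; case: (arg_minP g Pi0) => i Pi mi; exists i. Qed.

Lemma eventually_all (I : finType) (P : I -> nat -> Prop) :
  (forall i t t', (t <= t')%N -> P i t -> P i t') ->
  (forall i, exists t, P i t) -> exists t, forall i, P i t.
Proof.
move=> mono /choice[g Pg]; exists (\max_i g i)%N => i.
exact: mono (leq_bigmax i) (Pg i).
Qed.

Section Sources.
Variables (n : nat) (E : rel 'I_n) (f : nat).
Implicit Types (A B C D : {set 'I_n}) (i s t u v z : 'I_n).

(** When nonempty, this is the unique initial strongly connected component of [G - D]. *)
Definition source D : {set 'I_n} :=
  [set s | (s \notin D) &&
     [forall t, (t \notin D) ==> connect (induced_rel E D) s t]].

Lemma sourceP D s : reflect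
  (s \notin D /\ forall t, t \notin D -> connect (induced_rel E D) s t)
  (s \in source D).
Proof.
rewrite inE; apply: (iffP andP) => -[sD cs]; split=> //.
  by move=> t tD; move/forallP/(_ t): cs; rewrite tD.
by apply/forallP => t; apply/implyP; apply: cs.
Qed.

Lemma source_notin D s : s \in source D -> s \notin D.
Proof. by case/sourceP. Qed.

Hypothesis reach3 : three_reach E f.

(** Choose [s] with the smallest reach set. By 3-reach, [s] and any [t'] have a common ancestor [z];
    minimality gives [z] the same reach set as [s], so [s] reaches [z] and then [t']. *)
Lemma source_exists A B t : (#|A| <= f)%N -> (#|B| <= f)%N ->
  t \notin A :|: B -> exists s, s \in source (A :|: B).
Proof.
move=> cA cB tD; set D := A :|: B.
have [s sD mins] : exists2 s, s \notin D &
    forall s', s' \notin D -> (#|reach E D s| <= #|reach E D s'|)%N.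
  case: (@arg_minnP _ t (fun s => s \notin D) (fun s => #|reach E D s|) tD).
  by move=> s sD mins; exists s.
exists s; apply/sourceP; split=> // t' t'D.
have /set0Pn[z] := reach3 cA cB cB sD t'D.
rewrite in_setI ![_ \in reach _ _ _]inE => /andP[/andP[zD czt'] /andP[_ czs]].
have sub : reach E D z \subset reach E D s.
  apply/subsetP => y; rewrite !inE => /andP[-> /=] cyz.
  exact: connect_trans cyz czs.
have : s \in reach E D z.
  have ezs : reach E D z == reach E D s by rewrite eqEcard sub mins.
  rewrite (eqP ezs).
  by rewrite inE sD connect0.
by rewrite inE sD /= => csz; apply: connect_trans csz czt'.
Qed.

(** An ancestor of a source node is again a source node, so a common ancestor of one node from each
    source lies in both. *)
Lemma source_meet A B C u v :
  (#|A| <= f)%N -> (#|B| <= f)%N -> (#|C| <= f)%N ->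
  u \notin A :|: B -> v \notin A :|: C ->
  exists2 s, s \in source (A :|: B) & s \in source (A :|: C).
Proof.
move=> cA cB cC /(source_exists cA cB)[s sS] /(source_exists cA cC)[t tS].
have /set0Pn[z] := reach3 cA cB cC (source_notin sS) (source_notin tS).
rewrite !in_setI ![_ \in reach _ _ _]inE => /andP[/andP[zC czt] /andP[zB czs]].
exists z; apply/sourceP; split=> // y yD.
  by case/sourceP: sS => _ /(_ y yD); apply: connect_trans.
by case/sourceP: tS => _ /(_ y yD); apply: connect_trans.
Qed.

(** By [source_meet] with [C] empty, some [z] lies in both sources; [s] reaches [z] and, through it,
    every node outside [A]. *)
Lemma source_sub A B s : (#|A| <= f)%N -> (#|B| <= f)%N ->
  s \in source (A :|: B) -> s \in source A.
Proof.
move=> cA cB sS; have sN := source_notin sS.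
have sA : s \notin A by apply: contra sN; apply: (subsetP (subsetUl A B)).
have sA0 : s \notin A :|: set0 by rewrite setU0.
have [|z] := source_meet cA cB _ sN sA0; first by rewrite cards0.
rewrite setU0 => zB /sourceP[_ cz]; apply/sourceP; split=> // t tA.
apply: connect_trans (cz t tA); case/sourceP: sS => _ /(_ z (source_notin zB)).
apply: connect_sub => a b; rewrite /induced_rel /= !inE !negb_or.
case/and3P=> /andP[aA _] /andP[bA _] Eab; apply: connect1.
by rewrite /induced_rel /= aA bA.
Qed.

(* Paths are listed from the receiver back to the originator. *)
Definition backpath D i p z :=
  [/\ path (fun a b => E b a) i p, last i p = z & forall j, j \in p -> j \notin D].

Lemma source_backpath D s i :
  s \in source D -> i \notin D -> exists p, backpath D i p s.
Proof.
move=> /sourceP[_ cs] /cs /connectP[q]; elim: q s {cs} => [|a q IH] s /=.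
  by move=> _ ->; exists [::]; split.
case/andP => /and3P[sD aD Esa] /IH {}IH /IH[p [pp lp pD]].
exists (rcons p s); split; rewrite ?last_rcons ?rcons_path ?pp ?lp //.
by move=> j; rewrite mem_rcons inE => /orP[/eqP->|/pD].
Qed.

(** The path depends only on [D], [z] and [i]. Thus gathering with [A] against [B] and with [B]
    against [A] reads [z] along the same path, with the same result even if [z] is faulty. *)
Definition route D z i : seq 'I_n :=
  if pselect (exists p, backpath D i p z) is left w then projT1 (cid w)
  else [::].

Lemma routeP D z i : z \in source D -> i \notin D -> backpath D i (route D z i) z.
Proof.
move=> zS iD; rewrite /route; case: pselect => [w|[]]; first by case: (cid w).
exact: source_backpath.
Qed.

(** * Reports and their central points *)

Definition report : Type := ({set 'I_n} * {ffun 'I_n -> Real})%type.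
Implicit Type k : report.

(** For [B] the actual faulty set this places [p] among nonfaulty values; for [B] the set of another
    report it makes the two reports comparable. *)
Definition central (k : report) (p : Real) :=
  forall B t, (#|B| <= f)%N -> t \notin k.1 :|: B ->
  exists z z', [/\ z \in source (k.1 :|: B), z' \in source (k.1 :|: B) &
                   k.2 z' <= p <= k.2 z].

(* The point is the minimum over [B] of the maximum over [source (k.1 :|: B)]. *)
Lemma central_exists k : (#|k.1| <= f)%N -> exists p, central k p.
Proof.
case: k => A X /= cA.
pose ok (B : {set 'I_n}) := (#|B| <= f)%N && [exists t, t \notin A :|: B].
have [/existsP[B0 okB0]|/existsPn noB] := boolP [exists B, ok B]; last first.
  exists 0 => B t cB tB; case/negP: (noB B); rewrite /ok cB.
  by apply/existsP; exists t.
have [t0 _] : exists t, t \notin A :|: B0 by case/andP: okB0 => _ /existsP.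
have /choice[g Pg] (B : {set 'I_n}) : exists z, ok B -> z \in source (A :|: B) /\
    forall y, y \in source (A :|: B) -> X y <= X z.
  have [/andP[cB /existsP[t tB]]|_] := boolP (ok B); last by exists t0.
  have [s sS] := source_exists cA cB tB.
  by have [z zS mz] := @ex_maximum _ (mem (source (A :|: B))) X s sS; exists z.
have [B okB minB] := ex_minimum (fun B => X (g B)) okB0.
have [gS gmax] := Pg B okB; exists (X (g B)) => B' t cB' tB' /=.
have okB' : ok B' by rewrite /ok cB'; apply/existsP; exists t.
have cB : (#|B| <= f)%N by case/andP: okB.
(* Lower bound: a node common to both sources has value at most the maximum over [source (A :|: B)].
   Upper bound: the choice of [B] as minimiser. *)
have [z zB' zB] := source_meet cA cB' cB tB' (source_notin gS).
exists (g B'), z; split=> //; first by case: (Pg B' okB').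
by rewrite gmax // minB.
Qed.

(** A fixed choice determined by the report alone, so nodes that receive the same claim use the same
    number. *)
Definition point k : Real :=
  if pselect (exists p, central k p) is left w then projT1 (cid w) else 0.

Lemma pointP k : (#|k.1| <= f)%N -> central k (point k).
Proof.
move=> /central_exists ex; rewrite /point.
by case: pselect => [w|//]; case: (cid w).
Qed.
End Sources.

(** * Full-information executions *)

(** A message holds the input and the whole history of its sender, hence nested views. Equality on
    them is the classical one. *)
Inductive view (n : nat) := View of Real & seq ('I_n * view n).
HB.instance Definition _ n := gen_eqMixin (view n).

Section Observations.
Variable n : nat.
Notation history := (seq ('I_n * view n)).
Implicit Types (i j : 'I_n) (x : Real) (h g : history).

Definition observable (T : Type) : Type := 'I_n -> Real -> history -> option T.
Definition property (T : Type) : Type := 'I_n -> Real -> history -> T -> Prop.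

Definition stable T (Q : observable T) :=
  forall i x h g a, Q i x h = Some a -> Q i x (h ++ g) = Some a.
Definition monotone T (P : property T) :=
  forall i x h g a, P i x h a -> P i x (h ++ g) a.

Definition pick_prop T (P : T -> Prop) : option T :=
  if pselect (exists a, P a) is left w then Some (projT1 (cid w)) else None.

Lemma pick_propP T (P : T -> Prop) a : pick_prop P = Some a -> P a.
Proof. by rewrite /pick_prop; case: pselect => // w [<-]; case: (cid w). Qed.

Lemma pick_prop_ex T (P : T -> Prop) a : P a -> exists b, pick_prop P = Some b.
Proof.
move=> Pa; rewrite /pick_prop; case: pselect => [w|[]]; last by exists a.
by eexists.
Qed.

(* The first value ever to satisfy [P] is kept forever. *)
Definition latch T (P : property T) : observable T :=
  fun i x h => ohead (pmap (fun g => pick_prop (P i x g)) (prefixes h)).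

Lemma latch_stable T (P : property T) : stable (latch P).
Proof.
move=> i x h g a; rewrite /latch; have [s ->] := prefixes_cat h g.
by rewrite pmap_cat; case: (pmap _ _).
Qed.

Lemma ohead_pmap_Some (S : eqType) (U : Type) (F : S -> option U) s a :
  ohead (pmap F s) = Some a -> exists2 e, e \in s & F e = Some a.
Proof.
elim: s => //= e s IH; case Fe: (F e) => [b|] /=.
  by case=> <-; exists e; rewrite ?mem_head.
by move=> /IH[e' e's Fe']; exists e'; rewrite // inE e's orbT.
Qed.

Lemma ohead_pmap_ex (S : eqType) (U : Type) (F : S -> option U) s e a :
  e \in s -> F e = Some a -> exists b, ohead (pmap F s) = Some b.
Proof.
elim: s => //= e' s IH; rewrite inE => /orP[/eqP-> ->|es Fe]; first by exists a.
by case: (F e') => [b|] /=; [exists b | apply: IH].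
Qed.

Lemma latchP T (P : property T) i x h a :
  monotone P -> latch P i x h = Some a -> P i x h a.
Proof.
move=> mP hS; have [g gh Pg] := ohead_pmap_Some hS; move: (pick_propP Pg).
by have [l _ ->] := mapP gh; move=> /(mP _ _ _ (drop l h)); rewrite cat_take_drop.
Qed.

Lemma latch_ex T (P : property T) i x h a :
  P i x h a -> exists b, latch P i x h = Some b.
Proof.
move=> Pa; have [b Pb] := pick_prop_ex Pa.
apply: (@ohead_pmap_ex _ _ (fun g => pick_prop (P i x g)) _ _ _ _ Pb).
by apply/mapP; exists (size h); rewrite ?take_size // mem_iota /= add0n leqnn.
Qed.

(* What is first learnt about the observable [Q] of the originator of the
   backward path [p] from the nested views received along [p]. *)
Fixpoint hear T (Q : observable T) (p : seq 'I_n) : observable T :=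
  if p is j :: p' then fun i x h =>
    ohead (pmap (fun e => let: View y g := e.2 in
                          if e.1 == j then hear Q p' j y g else None) h)
  else Q.

Lemma hear_stable T (Q : observable T) p : stable Q -> stable (hear Q p).
Proof.
by case: p => [|j p] //= sQ i x h g a; rewrite pmap_cat; case: (pmap _ h).
Qed.

Definition full_info (dec : observable Real) : algorithm n (view n) :=
  Algorithm (fun _ x h _ => [:: View x h]) dec.

(** * What nonfaulty nodes learn along nonfaulty paths *)

Section Execution.
Variables (E : rel 'I_n) (dec : observable Real) (F : {set 'I_n}).
Variables (x : 'I_n -> Real) (hist : nat -> 'I_n -> history).
Hypothesis adm : admissible E (full_info dec) F x hist.

Lemma hist_cat i t t' : i \notin F -> (t <= t')%N ->
  exists g, hist t' i = hist t i ++ g.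
Proof.
move=> iF /subnKC <-; elim: (t' - t)%N => [|d [g Eg]].
  by exists [::]; rewrite addn0 cats0.
have [_ [step _]] := adm; rewrite addnS; have [->|[e ->]] := step (t + d)%N i iF.
  by exists g.
by exists (rcons g e); rewrite Eg rcons_cat.
Qed.

Lemma receive_sound t i j m : i \notin F -> j \notin F -> (j, m) \in hist t i ->
  exists s l, m = View (x j) (take l (hist s j)).
Proof.
move=> iF jF; have [h0 [_ [_ [safe _]]]] := adm.
case: t => [|t] mi; first by rewrite h0 in mi.
have : (0 < recv_count (hist t.+1 i) j m)%N.
  by rewrite /recv_count -has_count; apply/hasP; exists (j, m); rewrite /= ?eqxx.
move/leq_trans/(_ (safe t i j m iF jF)); rewrite sent_countE -has_count.
case/hasP => m' /flatten_mapP[g gh] /= + /eqP <-; rewrite inE => /eqP->.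
by have [l _ ->] := mapP gh; exists t, l.
Qed.

Lemma receive_complete t i j : i \notin F -> j \notin F -> E j i ->
  exists t', (j, View (x j) (hist t j)) \in hist t' i.
Proof.
move=> iF jF Eji; have [_ [_ [_ [_ live]]]] := adm.
have lji : link E j i by rewrite /link Eji.
have [t' let'] := live t i j (View (x j) (hist t j)) iF jF lji; exists t'.
have : (0 < recv_count (hist t' i) j (View (x j) (hist t j)))%N.
  apply: leq_trans let'; rewrite sent_countE -has_count.
  apply/hasP; exists (View (x j) (hist t j)); last by rewrite /= eqxx.
  apply/flatten_mapP; exists (hist t j); last by rewrite inE.
  by apply/mapP; exists (size (hist t j)); rewrite ?take_size // mem_iota /= add0n leqnn.
by rewrite /recv_count -has_count => /hasP[e ei /= /eqP <-].
Qed.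

Definition observed T (Q : observable T) i a :=
  exists t, Q i (x i) (hist t i) = Some a.

Definition holds T (P : property T) i a := exists t, P i (x i) (hist t i) a.

Lemma observed_uniq T (Q : observable T) i a b : stable Q -> i \notin F ->
  observed Q i a -> observed Q i b -> a = b.
Proof.
move=> sQ iF [t Qa] [t' Qb].
have [g Eg] := hist_cat iF (leq_maxl t t'); have [g' Eg'] := hist_cat iF (leq_maxr t t').
by apply: Some_inj; rewrite -(sQ _ _ _ g _ Qa) -Eg Eg'; apply: sQ.
Qed.

Lemma stable_later T (Q : observable T) i a t t' : stable Q -> i \notin F ->
  (t <= t')%N -> Q i (x i) (hist t i) = Some a -> Q i (x i) (hist t' i) = Some a.
Proof. by move=> sQ iF le Qa; have [g ->] := hist_cat iF le; apply: sQ. Qed.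

Lemma monotone_later T (P : property T) i a t t' : monotone P -> i \notin F ->
  (t <= t')%N -> P i (x i) (hist t i) a -> P i (x i) (hist t' i) a.
Proof. by move=> mP iF le Pa; have [g ->] := hist_cat iF le; apply: mP. Qed.

Lemma observed_latch T (P : property T) i a : monotone P ->
  observed (latch P) i a -> holds P i a.
Proof. by move=> mP [t La]; exists t; apply: latchP La. Qed.

Lemma holds_latch T (P : property T) i a :
  holds P i a -> exists b, observed (latch P) i b.
Proof. by move=> [t Pa]; have [b Lb] := latch_ex Pa; exists b, t. Qed.

(** Each nested view is a genuine prefix of the history of a nonfaulty node, and stability carries
    what is read there over to the full history. *)
Lemma hear_sound T (Q : observable T) p i a : stable Q ->
  i \notin F -> (forall j, j \in p -> j \notin F) ->
  observed (hear Q p) i a -> observed Q (last i p) a.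
Proof.
move=> sQ; elim: p i => [|j p IH] i iF pF //= [t /=].
have jF : j \notin F by apply: pF; rewrite mem_head.
move=> hS; have [[k [y g]] mi /=] := ohead_pmap_Some hS; case: eqP => // ekj hj; subst k.
have [s [l [ey eg]]] := receive_sound iF jF mi; subst y g.
apply: (IH j jF) => [k kp|]; first by apply: pF; rewrite inE kp orbT.
exists s; rewrite -(cat_take_drop l (hist s j)).
exact: hear_stable hj.
Qed.

(** Delivery only ensures that something is heard, perhaps from an earlier view; soundness and
    uniqueness identify it as [a]. *)
Lemma hear_complete T (Q : observable T) p i a : stable Q ->
  i \notin F -> path (fun a b => E b a) i p -> (forall j, j \in p -> j \notin F) ->
  observed Q (last i p) a -> observed (hear Q p) i a.
Proof.
move=> sQ; elim: p i => [|j p IH] i iF //= /andP[Eji pp] pF Qa.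
have jF : j \notin F by apply: pF; rewrite mem_head.
have pF' k : k \in p -> k \notin F by move=> kp; apply: pF; rewrite inE kp orbT.
have [t hj] := IH j jF pp pF' Qa; have [t' mi] := receive_complete t iF jF Eji.
have [b hb] : exists b, hear Q (j :: p) i (x i) (hist t' i) = Some b.
  by apply: (ohead_pmap_ex mi (a := a)); rewrite /= eqxx.
have ob : observed (hear Q (j :: p)) i b by exists t'.
rewrite (observed_uniq sQ _ Qa (hear_sound sQ iF pF ob)) //.
by case: (lastP p) pF' => //= q k pF'; rewrite last_rcons pF' // mem_rcons mem_head.
Qed.
End Execution.
End Observations.
Arguments latch_stable {n T} P.

(** * The protocol *)

Section Protocol.
Variables (n : nat) (E : rel 'I_n) (f : nat).
Notation source := (source E).
Notation route := (route E).
Notation report := (report n).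
Notation point := (point E f).
Implicit Types (A B : {set 'I_n}) (i z : 'I_n) (k : report).

(** [B] ranges over the candidates for the actual faulty set; the case [B = F] is the one whose
    routes are trustworthy. *)
Definition gathered T (Q : observable n T) A : property n ('I_n -> T) :=
  fun i x h c => [/\ (#|A| <= f)%N, i \notin A &
    forall B z, (#|B| <= f)%N -> i \notin B -> z \in source (A :|: B) ->
      hear Q (route (A :|: B) z i) i x h = Some (c z)].

(** Being zero off [source A] normalises [X]: equal values heard from the source give equal
    functions, which readiness compares. *)
Definition echo (Q : observable n Real) A : observable n {ffun 'I_n -> Real} :=
  latch (fun i x h (X : {ffun 'I_n -> Real}) =>
    gathered Q A i x h X /\ forall z, z \notin source A -> X z = 0).

Definition ready (Q : observable n Real) A : observable n {ffun 'I_n -> Real} :=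
  latch (fun i x h X => gathered (echo Q A) A i x h (fun=> X)).

Definition claim (Q : observable n Real) : observable n report :=
  latch (fun i x h k => gathered (ready Q k.1) k.1 i x h (fun=> k.2)).

Definition confirmed (Q : observable n Real) : property n report :=
  fun i x h k => (#|k.1| <= f)%N /\
    forall B, (#|B| <= f)%N -> i \notin B ->
    exists c p, [/\ backpath E B i p c, c \notin k.1 :|: B &
                    hear (ready Q k.1) p i x h = Some k.2].

Definition midpoint (K : {set 'I_n}) (k : 'I_n -> report) (y : Real) :=
  exists z1 z2, [/\ z1 \in K, z2 \in K,
    y = (point (k z1) + point (k z2)) / 2%:R &
    forall z, z \in K -> point (k z1) <= point (k z) <= point (k z2)].

Definition update (Q : observable n Real) : property n Real :=
  fun i x h y => exists A (k : 'I_n -> report),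
    [/\ gathered (claim Q) A i x h k,
        forall z, z \in source A -> confirmed Q i x h (k z) &
        midpoint (source A) k y].

Fixpoint value (r : nat) : observable n Real :=
  if r is s.+1 then latch (update (value s)) else fun _ x _ => Some x.

(** The report bounds the spread after round 1 by [eps * 2 ^ N]; [N] further halvings bring it to
    [eps], hence the value of round [N.+1]. *)
Definition may_decide (eps : Real) : property n Real :=
  fun i x h y => exists k N, [/\ confirmed (value 0) i x h k,
    forall z z', z \in source k.1 -> z' \in source k.1 ->
      k.2 z - k.2 z' <= eps * 2%:R ^+ N & value N.+1 i x h = Some y].

Definition decision eps := latch (may_decide eps).

Lemma gathered_monotone T (Q : observable n T) A :
  stable Q -> monotone (gathered Q A).
Proof.
move=> sQ i x h g c [cA iA hc]; split=> // B z cB iB zS.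
by apply: hear_stable => //; apply: hc.
Qed.

Lemma echo_monotone (Q : observable n Real) A : stable Q ->
  monotone (fun i x h (X : {ffun 'I_n -> Real}) =>
    gathered Q A i x h X /\ forall z, z \notin source A -> X z = 0).
Proof. by move=> sQ i x h g X [gX X0]; split=> //; apply: gathered_monotone. Qed.

Lemma ready_monotone (Q : observable n Real) A :
  monotone (fun i x h (X : {ffun 'I_n -> Real}) =>
    gathered (echo Q A) A i x h (fun=> X)).
Proof. by move=> i x h g X; apply: gathered_monotone; apply: latch_stable. Qed.

Lemma claim_monotone (Q : observable n Real) :
  monotone (fun i x h k => gathered (ready Q k.1) k.1 i x h (fun=> k.2)).
Proof. by move=> i x h g X; apply: gathered_monotone; apply: latch_stable. Qed.

Lemma confirmed_monotone (Q : observable n Real) : monotone (confirmed Q).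
Proof.
move=> i x h g k [ck ex]; split=> // B cB iB.
have [c [p [pc cN hc]]] := ex B cB iB; exists c, p; split=> //.
by apply: hear_stable => //; apply: latch_stable.
Qed.

Lemma update_monotone (Q : observable n Real) : monotone (update Q).
Proof.
move=> i x h g y [A [k [gk ck my]]]; exists A, k; split=> //.
  by apply: gathered_monotone => //; apply: latch_stable.
by move=> z zA; apply: confirmed_monotone; apply: ck.
Qed.

Lemma value_stable r : stable (value r).
Proof. by case: r => [|r] //; apply: latch_stable. Qed.
Arguments value_stable r : clear implicits.

Lemma may_decide_monotone eps : monotone (may_decide eps).
Proof.
move=> i x h g y [k [N [ck kN vy]]]; exists k, N; split=> //.
  exact: confirmed_monotone.
exact: value_stable.
Qed.

(** * Correctness of the protocol *)

Section Correctness.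
Hypothesis reach3 : three_reach E f.
Variables (eps : Real) (F : {set 'I_n}).
Hypotheses (eps_gt0 : 0 < eps) (cF : (#|F| <= f)%N).
Variables (x : 'I_n -> Real) (hist : nat -> 'I_n -> seq ('I_n * view n)).
Hypothesis adm : admissible E (full_info (decision eps)) F x hist.
Notation observed := (observed x hist).
Notation holds := (holds x hist).
Notation observed_uniq := (observed_uniq adm).

(** The instance [B = F] of gathering uses a route that avoids [F]. *)
Lemma gathered_sound T (Q : observable n T) A i c z : stable Q ->
  i \notin F -> holds (gathered Q A) i c -> z \in source (A :|: F) ->
  z \notin F /\ observed Q z (c z).
Proof.
move=> sQ iF [t [cA iA hc]] zS.
have iAF : i \notin A :|: F by rewrite inE negb_or iA.
have [pp lp pF] := routeP zS iAF; split.
  by have := source_notin zS; rewrite inE negb_or => /andP[].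
have ob : observed (hear Q (route (A :|: F) z i)) i (c z) by exists t; apply: hc.
rewrite -{1}lp; apply: (hear_sound adm sQ iF _ ob) => j /pF.
by rewrite inE negb_or => /andP[].
Qed.

(** With [A = F] every route avoids [F], so all finitely many observations arrive, by some common
    time. *)
Lemma gathered_complete T (Q : observable n T) i c : stable Q -> i \notin F ->
  (forall z, z \in source F -> observed Q z (c z)) ->
  holds (gathered Q F) i c.
Proof.
move=> sQ iF Qc.
pose P (Bz : {set 'I_n} * 'I_n) t := (#|Bz.1| <= f)%N -> i \notin Bz.1 ->
   Bz.2 \in source (F :|: Bz.1) ->
   hear Q (route (F :|: Bz.1) Bz.2 i) i (x i) (hist t i) = Some (c Bz.2).
have [||t Pt] := @eventually_all _ P.
- move=> [B z] t t' le Pt cB iB zS.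
  exact: (stable_later adm (hear_stable sQ) iF le (Pt cB iB zS)).
- move=> [B z]; rewrite /P /=.
  have [cB|] := boolP (#|B| <= f)%N; last by exists 0%N.
  have [iB|] := boolP (i \notin B); last by exists 0%N.
  have [zS|] := boolP (z \in source (F :|: B)); last by exists 0%N.
  have iFB : i \notin F :|: B by rewrite inE negb_or iF.
  have [pp lp pF] := routeP zS iFB.
  have Qz : observed Q (last i (route (F :|: B) z i)) (c z).
    by rewrite lp; apply: Qc; apply: source_sub cB zS.
  have [|t ht] := hear_complete adm sQ iF pp _ Qz; last by exists t.
  by move=> j /pF; rewrite inE negb_or => /andP[].
by exists t; split=> // B z; apply: (Pt (B, z)).
Qed.

(** * One round of averaging *)

Section Round.
Variable Q : observable n Real.
Hypothesis sQ : stable Q.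
Variable q : 'I_n -> Real.
Hypothesis Qq : forall i, i \notin F -> observed Q i (q i).

Lemma Q_uniq i y : i \notin F -> observed Q i y -> y = q i.
Proof. by move=> iF Qy; apply: observed_uniq Qy (Qq iF). Qed.

Lemma echo_sound A i X z : i \notin F -> observed (echo Q A) i X ->
  z \in source (A :|: F) -> X z = q z.
Proof.
move=> iF oX zS; have [t [gX _]] := observed_latch (@echo_monotone Q A sQ) oX.
have gX' : holds (gathered Q A) i X by exists t.
by have [zF Qz] := gathered_sound sQ iF gX' zS; apply: Q_uniq.
Qed.

Lemma ready_sound A i X z : i \notin F -> observed (ready Q A) i X ->
  z \in source (A :|: F) -> z \notin F /\ observed (echo Q A) z X.
Proof.
move=> iF oX zS; have gX := observed_latch (@ready_monotone Q A) oX.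
exact: gathered_sound (latch_stable _) iF gX zS.
Qed.

Lemma claim_sound i k z : i \notin F -> observed (claim Q) i k ->
  z \in source (k.1 :|: F) ->
  [/\ (#|k.1| <= f)%N, i \notin k.1, z \notin F & observed (ready Q k.1) z k.2].
Proof.
move=> iF oX zS; have [t gX] := observed_latch (@claim_monotone Q) oX.
have [ck ik _] := gX.
have gX' : holds (gathered (ready Q k.1) k.1) i (fun=> k.2) by exists t.
by have [zF Qz] := gathered_sound (latch_stable _) iF gX' zS; split.
Qed.

Definition good_report k := (#|k.1| <= f)%N /\
  exists2 c, c \notin k.1 :|: F & observed (ready Q k.1) c k.2.

(** The case [B = F] of confirmation: the path is nonfaulty, and so is the ready node at its end. *)
Lemma confirmed_good i k : i \notin F -> holds (confirmed Q) i k -> good_report k.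
Proof.
move=> iF [t [ck /(_ F cF iF)[c [p [[pp lp pF] cN hc]]]]]; split=> //.
exists c => //; rewrite -lp; apply: (hear_sound adm _ iF pF).
  exact: latch_stable.
by exists t.
Qed.

(** The ready node gathered echoes from [source (k.1 :|: F)], whose nodes are nonfaulty and gathered
    each other's true values. This source is nonempty because the ready node lies outside
    [k.1 :|: F]. *)
Lemma good_echo k : good_report k ->
  exists2 s, s \in source (k.1 :|: F) &
  forall z, z \in source (k.1 :|: F) ->
    [/\ z \notin F, observed (echo Q k.1) z k.2 & k.2 z = q z].
Proof.
move=> [ck [c cN oc]]; have cF' : c \notin F.
  by move: cN; rewrite inE negb_or => /andP[].
have [s sS] := source_exists reach3 ck cF cN; exists s => // z zS.
have [zF ez] := ready_sound cF' oc zS; split=> //.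
exact: echo_sound zF ez zS.
Qed.

Lemma good_point k : good_report k ->
  exists z z', [/\ z \notin F, z' \notin F & q z' <= point k <= q z].
Proof.
move=> gk; have [s sS good] := good_echo gk; case: gk => ck _.
have [z [z' [zS zS' le]]] := pointP reach3 ck cF (source_notin sS).
have [zF _ ez] := good z zS; have [zF' _ ez'] := good z' zS'.
by exists z, z'; rewrite -ez -ez'.
Qed.

(** [source (k.1 :|: F)] and [source (k'.1 :|: F)] share a nonfaulty [s] that echoed both reports,
    and [s] read [z] for both along the same route. The node [z] itself may be faulty. *)
Lemma good_agree k k' z : good_report k -> good_report k' ->
  z \in source (k.1 :|: k'.1) -> k.2 z = k'.2 z.
Proof.
move=> gk gk' zS; have [s0 s0S good] := good_echo gk.
have [s1 s1S good'] := good_echo gk'; have [[ck _] [ck' _]] := (gk, gk').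
have [||s sS sS'] := @source_meet _ _ _ reach3 F k.1 k'.1 s0 s1 cF ck ck'.
- by rewrite setUC; apply: source_notin s0S.
- by rewrite setUC; apply: source_notin s1S.
rewrite ![F :|: _]setUC in sS sS'.
have [sF oX _] := good s sS; have [_ oX' _] := good' s sS'.
have [t [[_ sk hk] _]] := observed_latch (@echo_monotone Q k.1 sQ) oX.
have [t' [[_ sk' hk'] _]] := observed_latch (@echo_monotone Q k'.1 sQ) oX'.
have ob : observed (hear Q (route (k.1 :|: k'.1) z s)) s (k.2 z).
  by exists t; apply: hk.
have ob' : observed (hear Q (route (k.1 :|: k'.1) z s)) s (k'.2 z).
  by exists t'; rewrite setUC in zS *; apply: hk'.
exact: observed_uniq (hear_stable sQ) sF ob ob'.
Qed.

(** Centrality of [point k] for [B = k'.1] bounds it by values of [k] on [source (k.1 :|: k'.1)],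
    where the two reports agree. *)
Lemma good_point_bound k k' : good_report k -> good_report k' ->
  exists z z', [/\ z \in source k'.1, z' \in source k'.1 &
                   k'.2 z' <= point k <= k'.2 z].
Proof.
move=> gk gk'; have [s0 s0S _] := good_echo gk; have [s1 s1S _] := good_echo gk'.
have [[ck _] [ck' _]] := (gk, gk').
have [||s sS sS'] := @source_meet _ _ _ reach3 F k.1 k'.1 s0 s1 cF ck ck'.
- by rewrite setUC; apply: source_notin s0S.
- by rewrite setUC; apply: source_notin s1S.
have sN : s \notin k.1 :|: k'.1.
  have := source_notin sS; have := source_notin sS'; rewrite !inE !negb_or.
  by move=> /andP[_ ->] /andP[_ ->].
have [z [z' [zS zS' le]]] := pointP reach3 ck ck' sN.
exists z, z'; rewrite -!(good_agree gk gk') //; split=> //.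
  by move: zS; rewrite setUC; exact: (source_sub reach3 ck' ck).
by move: zS'; rewrite setUC; exact: (source_sub reach3 ck' ck).
Qed.

(** For each [B], the sources of [F :|: k.1] and [F :|: B] share a node [c]. The claim makes [c]
    ready, and [c] reaches [i] outside [F :|: B]. *)
Lemma claim_confirmed i j k : i \notin F -> j \notin F ->
  observed (claim Q) j k -> holds (confirmed Q) i k.
Proof.
move=> iF jF ck.
have [t [cA jA _]] := observed_latch (@claim_monotone Q) ck.
pose P B t := (#|B| <= f)%N -> i \notin B ->
    exists c p, [/\ backpath E B i p c, c \notin k.1 :|: B &
                    hear (ready Q k.1) p i (x i) (hist t i) = Some k.2].
have [||t' Pt] := @eventually_all _ P; last by exists t'; split.
  move=> B t1 t2 le P1 cB iB; have [c [p [pc cN hc]]] := P1 cB iB.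
  exists c, p; split=> //; apply: (stable_later adm _ iF le hc).
  by apply: hear_stable; apply: latch_stable.
move=> B; rewrite /P; have [cB|] := boolP (#|B| <= f)%N; last by exists 0%N.
have [iB|] := boolP (i \notin B); last by exists 0%N.
have jFk : j \notin F :|: k.1 by rewrite inE negb_or jF.
have iFB : i \notin F :|: B by rewrite inE negb_or iF.
have [c cS cS'] := source_meet reach3 cF cA cB jFk iFB.
have [p [pp lp pN]] := source_backpath cS' iFB.
rewrite setUC in cS; have [_ _ cF' oc] := claim_sound jF ck cS.
have pF u : u \in p -> u \notin F /\ u \notin B.
  by move/pN; rewrite inE negb_or => /andP[].
have pF' u : u \in p -> u \notin F by case/pF.
have oc' : observed (ready Q k.1) (last i p) k.2 by rewrite lp.
have [t1 ht] := hear_complete adm (latch_stable _) iF pp pF' oc'.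
exists t1 => _ _; exists c, p; split=> //; first by split=> // u /pF[].
have := source_notin cS; have := source_notin cS'.
by rewrite !inE !negb_or => /andP[_ ->] /andP[->].
Qed.

(** The true set [F] with the true values on its source passes every stage, so some claim is made,
    though perhaps an earlier one. *)
Lemma claim_total i : i \notin F -> exists k, observed (claim Q) i k.
Proof.
pose X : {ffun 'I_n -> Real} := [ffun z => if z \in source F then q z else 0].
have srcF z : z \in source F -> z \notin F by apply: source_notin.
have srcFF z : z \in source F -> z \in source (F :|: F) by rewrite setUid.
have echoX j : j \notin F -> observed (echo Q F) j X.
  move=> jF; have [|t gX] := @gathered_complete _ Q j X sQ jF.
    by move=> z zS; rewrite ffunE zS; apply: Qq; apply: srcF.
  have [Y oY] : exists Y, observed (echo Q F) j Y.
    apply: holds_latch; exists t; split; first exact: gX.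
    by move=> z zS; rewrite ffunE (negbTE zS).
  (* The latch may have kept another [Y], but soundness fixes it on [source F] and normalisation
     elsewhere. *)
  suff -> : X = Y by [].
  apply/ffunP => z; rewrite ffunE; case: ifP => [zS|/negbT zS].
    by rewrite (echo_sound jF oY) ?srcFF.
  by have [t' [_ ->]] := observed_latch (@echo_monotone Q F sQ) oY.
have readyX j : j \notin F -> observed (ready Q F) j X.
  move=> jF; have [||t gX] := @gathered_complete _ (echo Q F) j (fun=> X) _ jF.
  - exact: latch_stable.
  - by move=> z zS; apply: echoX; apply: srcF.
  have [Y oY] : exists Y, observed (ready Q F) j Y.
    by apply: holds_latch; exists t; apply: gX.
  have jFF : j \notin F :|: F by rewrite setUid.
  have [s sS] := source_exists reach3 cF cF jFF.
  have [sF os] := ready_sound jF oY sS.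
  (* Readiness for [Y] means that some nonfaulty [s] echoed [Y], while every nonfaulty node echoes
     [X]. *)
  by rewrite (observed_uniq (latch_stable _) sF (echoX s sF) os).
move=> iF; have [||t gX] := @gathered_complete _ (ready Q F) i (fun=> X) _ iF.
- exact: latch_stable.
- by move=> z zS; apply: readyX; apply: srcF.
have gk : holds (fun i x h k => gathered (ready Q k.1) k.1 i x h (fun=> k.2)) i (F, X).
  by exists t.
exact: holds_latch gk.
Qed.

(** [A = F] serves as witness: the nodes of [source F] are nonfaulty, so they all make claims, and
    these get confirmed. *)
Lemma update_total i : i \notin F -> exists y, observed (latch (update Q)) i y.
Proof.
move=> iF.
have /choice[k kP] j : exists k, j \notin F -> observed (claim Q) j k.
  have [jF|_] := boolP (j \notin F); last by exists (F, [ffun=> 0]).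
  by have [k ck] := claim_total jF; exists k.
have srcF z : z \in source F -> z \notin F by apply: source_notin.
have [||t1 gk] := @gathered_complete _ (claim Q) i k _ iF.
- exact: latch_stable.
- by move=> z /srcF; apply: kP.
pose P z t := z \in source F -> confirmed Q i (x i) (hist t i) (k z).
have [||t2 ck] := @eventually_all _ P.
- move=> z t t' le Pt zS.
  exact: (monotone_later adm (@confirmed_monotone Q) iF le (Pt zS)).
- move=> z; rewrite /P; have [zS|] := boolP (z \in source F); last by exists 0%N.
  by have [t ct] := claim_confirmed iF (srcF z zS) (kP z (srcF z zS)); exists t.
have iFF : i \notin F :|: F by rewrite setUid.
have [s sS] := source_exists reach3 cF cF iFF; rewrite setUid in sS.
have [z1 z1S min1] := @ex_minimum _ (mem (source F)) (fun z => point (k z)) s sS.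
have [z2 z2S max2] := @ex_maximum _ (mem (source F)) (fun z => point (k z)) s sS.
apply: (@holds_latch _ _ _ _ _ _ ((point (k z1) + point (k z2)) / 2%:R)).
exists (maxn t1 t2), F, k; split.
- apply: (monotone_later adm _ iF (leq_maxl t1 t2) gk).
  by apply: gathered_monotone; apply: latch_stable.
- move=> z zS; apply: (monotone_later adm (@confirmed_monotone Q) iF (leq_maxr t1 t2)).
  exact: ck.
by exists z1, z2; split=> // z zS; rewrite min1 ?max2.
Qed.

Lemma update_sound i y : i \notin F -> observed (latch (update Q)) i y ->
  exists A (k : 'I_n -> report), [/\ (#|A| <= f)%N /\ i \notin A,
    forall z, z \in source (A :|: F) -> z \notin F /\ observed (claim Q) z (k z),
    forall z, z \in source A -> good_report (k z) & midpoint (source A) k y].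
Proof.
move=> iF oy; have [t [A [k [gk ck my]]]] := observed_latch (@update_monotone Q) oy.
exists A, k; split=> //; first by case: gk.
  have gk' : holds (gathered (claim Q) A) i k by exists t.
  by move=> z zS; apply: gathered_sound (latch_stable _) iF gk' zS.
by move=> z zS; apply: (confirmed_good iF); exists t; apply: ck.
Qed.

Lemma update_between i y : i \notin F -> observed (latch (update Q)) i y ->
  exists k1 k2, [/\ good_report k1, good_report k2 & point k1 <= y <= point k2].
Proof.
move=> iF /(update_sound iF)[A [k [_ _ good [z1 [z2 [z1S z2S -> le12]]]]]].
exists (k z1), (k z2); split; [exact: good | exact: good |].
by have /andP[_ le] := le12 z1 z1S; apply/andP; split; lra.
Qed.

Lemma update_valid i y : i \notin F -> observed (latch (update Q)) i y ->
  exists j j', [/\ j \notin F, j' \notin F & q j <= y <= q j'].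
Proof.
move=> iF /(update_between iF)[k1 [k2 [/good_point[_ [j [_ jF /andP[le1 _]]]]]]].
move=> /good_point[j' [_ [j'F _ /andP[_ le2]]]] /andP[ley yle].
by exists j, j'; rewrite (le_trans le1 ley) (le_trans yle le2).
Qed.

(** The bound uses only data in one confirmed report, so a single node can evaluate it without
    knowing [F]. *)
Lemma update_bound i j y y' k : i \notin F -> j \notin F -> good_report k ->
  observed (latch (update Q)) i y -> observed (latch (update Q)) j y' ->
  exists z z', [/\ z \in source k.1, z' \in source k.1 & y - y' <= k.2 z - k.2 z'].
Proof.
move=> iF jF gk /(update_between iF)[_ [k2 [_ gk2 /andP[_ yle]]]].
move=> /(update_between jF)[k1 [_ [gk1 _ /andP[ley' _]]]].
have [z [_ [zS _ /andP[_ le2]]]] := good_point_bound gk2 gk.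
have [_ [z' [_ z'S /andP[le1 _]]]] := good_point_bound gk1 gk.
by exists z, z'; split=> //; lra.
Qed.

(* A common nonfaulty origin [w] of claims makes the hulls of reported points
   intersect at the point of the claim of [w]. *)
Lemma update_contract D i j y y' : i \notin F -> j \notin F ->
  (forall a b, a \notin F -> b \notin F -> q a - q b <= D) ->
  observed (latch (update Q)) i y -> observed (latch (update Q)) j y' ->
  y - y' <= D / 2%:R.
Proof.
move=> iF jF leD.
move=> /(update_sound iF)[A [k [[cA iA] ck gk [z1 [z2 [z1S z2S -> le12]]]]]].
move=> /(update_sound jF)[B [l [[cB jB] cl gl [v1 [v2 [v1S v2S -> lev12]]]]]].
have iFA : i \notin F :|: A by rewrite inE negb_or iF.
have jFB : j \notin F :|: B by rewrite inE negb_or jF.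
have [w wA wB] := source_meet reach3 cF cA cB iFA jFB.
rewrite ![F :|: _]setUC in wA wB.
have [wF cw] := ck w wA; have [_ cw'] := cl w wB.
have ekl : k w = l w := observed_uniq (latch_stable _) wF cw cw'.
have /andP[lek _] := le12 w (source_sub reach3 cA cF wA).
have /andP[_ lel] := lev12 w (source_sub reach3 cB cF wB).
have [a [_ [aF _ /andP[_ lea]]]] := good_point (gk z2 z2S).
have [_ [b [_ bF /andP[leb _]]]] := good_point (gl v1 v1S).
by have := leD a b aF bF; rewrite ekl in lek; lra.
Qed.
End Round.

(** * Iterating the rounds and deciding *)

Lemma values_exist : exists q : nat -> 'I_n -> Real,
  forall r i, i \notin F -> observed (value r) i (q r i).
Proof.
suff ex r : exists q, forall i, i \notin F -> observed (value r) i (q i).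
  by have [q qP] := choice ex; exists q.
elim: r => [|r [q qP]]; first by exists x => i _; exists 0%N.
suff ex i : exists y, i \notin F -> observed (value r.+1) i y.
  by have [q' q'P] := choice ex; exists q'.
have [iF|_] := boolP (i \notin F); last by exists 0.
by have [y oy] := update_total (value_stable r) qP iF; exists y.
Qed.

Lemma decision_correct :
  (forall i, i \notin F -> exists y, outputs (full_info (decision eps)) x hist i y) /\
  (forall i j yi yj, i \notin F -> j \notin F ->
     outputs (full_info (decision eps)) x hist i yi ->
     outputs (full_info (decision eps)) x hist j yj -> `|yi - yj| <= eps) /\
  (forall i y, i \notin F -> outputs (full_info (decision eps)) x hist i y ->
     exists j j', [/\ j \notin F, j' \notin F & x j <= y <= x j']).
Proof.
have [q qP] := values_exist.
have q0 i : i \notin F -> q 0%N i = x i.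
  move=> iF; apply: (observed_uniq (value_stable 0) iF (qP 0%N i iF)).
  by exists 0%N.
have hull r d i : i \notin F ->
    exists j j', [/\ j \notin F, j' \notin F & q r j <= q (r + d)%N i <= q r j'].
  elim: d i => [|d IH] i iF; first by exists i, i; rewrite addn0 lexx.
  have := qP (r + d.+1)%N i iF; rewrite addnS => oy.
  have [j [j' [jF j'F /andP[le1 le2]]]] :=
    update_valid (value_stable _) (qP (r + d)%N) iF oy.
  have [a [_ [aF _ /andP[lea _]]]] := IH j jF.
  have [_ [b [_ bF /andP[_ leb]]]] := IH j' j'F.
  by exists a, b; rewrite (le_trans lea le1) (le_trans le2 leb).
have dec_sound i y : i \notin F -> observed (decision eps) i y ->
    exists N, y = q N.+1 i /\
      forall a b, a \notin F -> b \notin F -> q N.+1 a - q N.+1 b <= eps.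
  move=> iF oy.
  have [t [k [N [ck kN vy]]]] := observed_latch (@may_decide_monotone eps) oy.
  exists N; split.
    apply: (observed_uniq (value_stable N.+1) iF _ (qP N.+1 i iF)).
    by exists t.
  have gk : good_report (value 0) k by apply: (confirmed_good iF); exists t.
  (* Base case: the report bounds the spread of round 1. Each later round halves it. *)
  suff shrink d a b : (d <= N)%N -> a \notin F -> b \notin F ->
      q d.+1 a - q d.+1 b <= eps * 2%:R ^+ (N - d).
    by move=> a b aF bF; have := shrink N a b (leqnn N) aF bF; rewrite subnn mulr1.
  elim: d a b => [|d IH] a b led aF bF.
    have [z [z' [zS z'S le]]] := update_bound (value_stable 0) (qP 0%N)
      aF bF gk (qP 1%N a aF) (qP 1%N b bF).
    by rewrite subn0 (le_trans le) ?kN.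
  have := update_contract (value_stable _) (qP d.+1) aF bF
    (fun a b => IH a b (ltnW led)) (qP d.+2 a aF) (qP d.+2 b bF).
  by rewrite -(subnSK led) exprS; lra.
have out_dec i y : outputs (full_info (decision eps)) x hist i y ->
    observed (decision eps) i y by case=> t [dy _]; exists t.
split; [move=> i iF | split].
(* Termination: the first update already supplies a confirmed report, and some power of two exceeds
   its spread divided by [eps]. *)
- have [t [A [k [_ ck [z1 [_ [z1S _ _ _]]]]]]] :=
    observed_latch (@update_monotone (value 0)) (qP 1%N i iF).
  have {}ck := ck z1 z1S; set kz := k z1 in ck.
  have [[a b] _ max_ab] := @ex_maximum _ predT
    (fun ab : 'I_n * 'I_n => kz.2 ab.1 - kz.2 ab.2) (i, i) isT.
  set D := kz.2 a - kz.2 b in max_ab; pose N := Num.bound (D / eps).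
  have leDN : D <= eps * 2%:R ^+ N.
    rewrite mulrC -ler_pdivrMr //; apply: ltW.
    exact: upper_nthrootP (leqnn N).
  have [t' vt'] := qP N.+1 i iF.
  have [y [u oy]] : exists y, observed (decision eps) i y.
    apply: (@holds_latch _ _ _ _ _ _ (q N.+1 i)); exists (maxn t t'), kz, N; split.
    + exact: (monotone_later adm (@confirmed_monotone _) iF (leq_maxl t t') ck).
    + by move=> z z' _ _; apply: le_trans leDN; apply: (max_ab (z, z')).
    exact: (stable_later adm (value_stable _) iF (leq_maxr t t') vt').
  have ex_dec : exists v, isSome (decision eps i (x i) (hist v i)).
    by exists u; rewrite oy.
  case: (ex_minnP ex_dec) => v; case ev: (decision _ _ _ _) => [y'|//] _ minv.
  exists y', v; split=> // s ltsv; case es: (a_dec _ _ _ _) => [c|] //.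
  move: (minv s); rewrite -[decision _ _ _ _]/(a_dec (full_info _) _ _ _) es.
  by rewrite leqNgt ltsv => /(_ isT).
- move=> i j yi yj iF jF /out_dec/(dec_sound i yi iF)[N [-> leN]].
  move=> /out_dec/(dec_sound j yj jF)[M [-> leM]].
  (* The nodes may stop in different rounds; the later value lies in the hull of the values of the
     earlier round, all within [eps] of the earlier output. *)
  have [leNM|/ltnW leMN] := leqP N M.
    have [a [b [aF bF /andP[lea leb]]]] := hull N.+1 (M - N)%N j jF.
    rewrite addSn subnKC // in lea leb.
    have h1 := leN i a iF aF; have h2 := leN b i bF iF.
    by rewrite ler_norml; apply/andP; split; lra.
  have [a [b [aF bF /andP[lea leb]]]] := hull M.+1 (N - M)%N i iF.
  rewrite addSn subnKC // in lea leb.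
  have h1 := leM j a jF aF; have h2 := leM b j bF jF.
  by rewrite ler_norml; apply/andP; split; lra.
move=> i y iF /out_dec/(dec_sound i y iF)[N [-> _]].
have [a [b [aF bF le]]] := hull 0%N N.+1 i iF.
by exists a, b; rewrite -!q0.
Qed.
End Correctness.
End Protocol.

Theorem theorem2p7 (n : nat) (E : rel 'I_n) (f : nat) :
  irreflexive E ->
  approx_consensus_possible E f <-> three_reach E f.
Proof.
move=> _; split; first exact: three_reach_necessary.
move=> reach3 eps eps_gt0; exists (view n), (full_info (decision E f eps)).
by move=> F cF x hist adm; apply: decision_correct adm.
Qed.
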